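(* Let $(L,\vee,\wedge)$ be a lattice and $a,b\in L$ with $a<b$, and assume that the interval $[a,b]$ is complemented. Assume moreover that $[a,b]$ is finite and that the mapping $x\mapsto(x^{ab})^{ab}$ from $[a,b]$ to $2^{[a,b]}$ is injective, and let $c\in[a,b]$. Then there exists some $d\in(c^{ab})^{ab}$ with $(d^{ab})^{ab}=\{d\}$.
   Context: Here $[a,b]=\{w\in L\mid a\le w\le b\}$. For $x\in[a,b]$, $x^{ab}:=\{y\in[a,b]\mid x\vee y=b\text{ and }x\wedge y=a\}$; for a subset $A\subseteq[a,b]$, $A^{ab}:=\{y\in[a,b]\mid x\vee y=b\text{ and }x\wedge y=a\text{ for all }x\in A\}$. Saying that $[a,b]$ is complemented means $x^{ab}\neq\emptyset$ for all $x\in[a,b]$. *)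

(* Defs.v *)
From mathcomp Require Import all_boot all_order.
From mathcomp Require Import interval.
From mathcomp Require Import boolp classical_sets functions cardinality.

Set Implicit Arguments.
Unset Strict Implicit.
Unset Printing Implicit Defensive.

Import Order.TTheory.

Local Open Scope classical_set_scope.

(* The interval `[a, b] is a subset of an arbitrary, possibly infinite,
   lattice, so these are sets in the sense of [classical_sets].  The infixes
   [`&`] and [`|`] under %O are lattice operations, not set operations. *)

Definition compl_elt {disp : Order.disp_t} {L : latticeType disp} (a b x : L) :
    set L :=
  [set y | [/\ `[a, b] y, (x `|` y)%O = b & (x `&` y)%O = a]].

Definition compl_set {disp : Order.disp_t} {L : latticeType disp} (a b : L)
    (A : set L) : set L :=
  [set y | `[a, b] y /\
           forall x, A x -> (x `|` y)%O = b /\ (x `&` y)%O = a].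

Definition complemented_itv {disp : Order.disp_t} {L : latticeType disp}
    (a b : L) : Prop :=
  forall x, `[a, b] x -> compl_elt a b x !=set0.

(* Main.v *)
Require Import Defs.
From mathcomp Require Import all_boot all_order.
From mathcomp Require Import finmap.
From mathcomp Require Import interval.
From mathcomp Require Import boolp classical_sets functions cardinality.

(** Write [F x] for the double complement [compl_set a b (compl_elt a b x)].
    Taking complements is an antitone Galois correspondence, so [x] lies in
    [F x] and [e] in [F x] implies that [F e] is included in [F x].  If [F c]
    is not reduced to [c], any other element [e] of [F c] has, by injectivity
    of [F], a strictly smaller double complement.  Since the interval is
    finite this descent stops, and it can only stop at some [d] with
    [F d = [set d]]; by [bicompl_sub], such a [d] still lies in the initial
    [F c]. *)

Set Implicit Arguments.
Unset Strict Implicit.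
Unset Printing Implicit Defensive.

Import Order.TTheory.

Local Open Scope classical_set_scope.

Lemma bicompl_refl (disp : Order.disp_t) (L : latticeType disp) (a b x : L) :
  `[a, b] x -> compl_set a b (compl_elt a b x) x.
Proof.
move=> abx; split=> // y [_ xyb xya].
by rewrite joinC meetC.
Qed.

(** An element [e] of the double complement of [x] has every complement of
    [x] among its own, and the outer complementation reverses inclusions. *)
Lemma bicompl_sub (disp : Order.disp_t) (L : latticeType disp) (a b x e : L) :
  compl_set a b (compl_elt a b x) e ->
  compl_set a b (compl_elt a b e) `<=` compl_set a b (compl_elt a b x).
Proof.
move=> [_ xe] z [abz ez]; split=> // y xy.
apply: ez; have [yeb yea] := xe y xy; case: xy => aby _ _.
by split=> //; rewrite (joinC, meetC).
Qed.

Theorem proposition3p3 (disp : Order.disp_t) (L : latticeType disp) (a b : L)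
    (ltab : (a < b)%O)
    (compl_ab : complemented_itv a b)
    (fin_ab : finite_set `[a, b])
    (inj_ab : set_inj `[a, b] (fun x => compl_set a b (compl_elt a b x)))
    (c : L) (c_ab : `[a, b] c) :
  exists d : L, compl_set a b (compl_elt a b c) d /\
    compl_set a b (compl_elt a b d) = [set d].
Proof.
pose F x := compl_set a b (compl_elt a b x).
have finF x : finite_set (F x) by apply: sub_finite_set fin_ab => y [].
have [n] := ubnP #|` fset_set (F c)|.
elim: n c c_ab => // n IHn c c_ab; rewrite ltnS => leFn.
have [Fc1|Fc1] := pselect (F c = [set c]).
  by exists c; split=> //; exact: bicompl_refl.
have [e [Fce ec]] : exists e, F c e /\ e <> c.
  apply: contrapT => noe; apply: Fc1; apply/seteqP; split=> x /=.
    by move=> Fcx; apply: contrapT => xc; apply: noe; exists x.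
  by move=> ->; exact: bicompl_refl.
have e_ab : `[a, b] e by case: Fce.
have FeFc : F e `<` F c.
  rewrite properEneq; split; last exact: bicompl_sub.
  by apply/eqP => /inj_ab; rewrite !inE => /(_ e_ab c_ab).
have [d [Fed Fd1]] : exists d, F e d /\ F d = [set d].
  apply: IHn e_ab (leq_trans _ leFn).
  apply: fproper_ltn_card; case: FeFc => FeFc FcFe.
  by rewrite /fproper; apply/andP; split; [|apply/negP]; rewrite -fset_set_sub.
by exists d; split=> //; exact: bicompl_sub Fed.
Qed.
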